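(* Let $S=(d_1,\ldots,d_n)$ be a weakly decreasing sequence of integers on which the modified Havel-Hakimi algorithm terminates successfully with a connected graph $G$ on the vertices $v_1,\dots,v_n$. For $1\le i\le n$ let $G_i$ be the subgraph of $G$ induced by $v_1,\dots,v_i$. Then $G_i$ is an isometric subgraph of $G$ for every $1\le i\le n$; in particular, $G$ is distance-preserving.
   Context: All graphs are finite and simple. For a graph $G$, $d_G(u,v)$ denotes the distance between $u$ and $v$ in $G$. A subgraph $H$ of a connected graph $G$ is isometric if $d_H(u,v)=d_G(u,v)$ for every $u,v\in V(H)$. A connected graph $G$ on $n$ vertices is distance-preserving (dp) if it contains at least one isometric subgraph with exactly $k$ vertices for every $k$ with $1\le k\le n$. Modified Havel-Hakimi algorithm. The input is a weakly decreasing sequence of integers $(d_1,\dots,d_n)$. The algorithm tries to construct a graph with vertices $v_1,\dots,v_n$, starting with no edges, in which $\deg v_i=d_i$ for all $i$. At every stage there is a current list of vertices, kept in the original order of increasing subscripts, together with their current (residual) degrees; initially this is the list $v_1,\dots,v_n$ with residual degrees $d_1,\dots,d_n$. The main loop, applied to a current nonempty list $w_1,\dots,w_m$ with residual degrees $e_1,\dots,e_m$, is: (a) Add edges from $w_1$ to $w_2,\dots,w_{e_1+1}$ (this is possible exactly when $0\le e_1\le m-1$). (b) Remove $w_1$ (and $e_1$) from the list and subtract one from each of $e_2,\dots,e_{e_1+1}$. (c) Remove from the list all vertices whose residual degree is now zero, keeping the remaining vertices in the same relative order (no rearrangement into weakly decreasing order is done, in contrast to the usual Havel-Hakimi algorithm).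 The loop is iterated. If the empty list is reached, the algorithm terminates successfully and its output is the constructed graph $G$ on $v_1,\dots,v_n$. If at some point step (a) is impossible, the algorithm terminates unsuccessfully. *)

(* Defs.v *)
From HB Require Import structures.
From mathcomp Require Import all_boot all_order all_algebra.

Set Implicit Arguments.
Unset Strict Implicit.
Unset Printing Implicit Defensive.

Import Order.TTheory GRing.Theory Num.Theory.

Section Graphs.

Variable V : finType.

(* A finite simple graph whose vertices lie in the ambient finite type [V], so
   that a graph and its subgraphs have the same type. *)
Record graph : Type := Graph {
  vset : {set V};
  adj : rel V;
  adj_sym : symmetric adj;
  adj_irr : irreflexive adj;
  adj_vset : forall u v, adj u v -> u \in vset
}.

Definition walk (G : graph) (k : nat) (u v : V) : bool :=
  [exists p : k.-tuple V, path (adj G) u p && (last u p == v)].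

(* The least length of a walk from u to v, with [None] as infinite distance.
   Lengths below #|V| suffice, since a shortest walk repeats no vertex; see
   [dist_Some] and [dist_None]. *)
Definition dist (G : graph) (u v : V) : option nat :=
  ohead [seq k <- iota 0 #|V| | walk G k u v].

Definition connected (G : graph) : Prop :=
  {in vset G &, forall u v, connect (adj G) u v}.

Definition subgraph (H G : graph) : Prop :=
  vset H \subset vset G /\ subrel (adj H) (adj G).

Definition isometric_subgraph (H G : graph) : Prop :=
  subgraph H G /\ {in vset H &, forall u v, dist H u v = dist G u v}.

Definition distance_preserving (G : graph) : Prop :=
  connected G /\
  forall k : nat, 1 <= k <= #|vset G| ->
    exists H : graph, isometric_subgraph H G /\ #|vset H| = k.

Section Induced.
Variables (G : graph) (A : {set V}).

Definition induced_adj : rel V :=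
  [rel u v | [&& adj G u v, u \in A & v \in A]].

Lemma induced_sym : symmetric induced_adj.
Proof. by move=> u v; rewrite /induced_adj /= adj_sym [(u \in A) && _]andbC. Qed.

Lemma induced_irr : irreflexive induced_adj.
Proof. by move=> u; rewrite /induced_adj /= adj_irr. Qed.

Lemma induced_vset u v : induced_adj u v -> u \in vset G :&: A.
Proof. by case/and3P=> /adj_vset uG uA _; rewrite inE uG. Qed.

Definition induced : graph := Graph induced_sym induced_irr induced_vset.
End Induced.

Section Edgeless.

Lemma edgeless_sym : symmetric (fun _ _ : V => false).
Proof. by []. Qed.

Lemma edgeless_irr : irreflexive (fun _ _ : V => false).
Proof. by []. Qed.

Lemma edgeless_vset (u v : V) : false -> u \in [set: V].
Proof. by []. Qed.

Definition edgeless : graph := Graph edgeless_sym edgeless_irr edgeless_vset.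
End Edgeless.

Section AddEdges.
Variables (G : graph) (w : V) (s : seq V).

(* The first three conditions only make the operation total: during the
   algorithm every element of V is a vertex and w does not occur in s. *)
Definition add_edges_adj : rel V :=
  [rel u v | adj G u v ||
    [&& u \in vset G, v \in vset G, u != v &
        ((u == w) && (v \in s)) || ((v == w) && (u \in s))]].

Lemma add_edges_sym : symmetric add_edges_adj.
Proof.
by move=> u v; rewrite /add_edges_adj /= adj_sym andbCA eq_sym [X in [&& _, _, _ & X]]orbC.
Qed.

Lemma add_edges_irr : irreflexive add_edges_adj.
Proof. by move=> u; rewrite /add_edges_adj /= adj_irr eqxx !andbF. Qed.

Lemma add_edges_vset u v : add_edges_adj u v -> u \in vset G.
Proof. by case/orP=> [/adj_vset //|/andP[]]. Qed.

Definition add_edges : graph :=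
  Graph add_edges_sym add_edges_irr add_edges_vset.
End AddEdges.

(* The list s left once a head of residual degree k has been removed and joined
   to the next k vertices; no rearrangement into decreasing order is done. *)
Definition mhh_update (k : nat) (s : seq (V * int)) : seq (V * int) :=
  [seq x <- [seq (x.1, x.2 - 1)%R | x <- take k s] ++ drop k s | x.2 != 0%R].

(* [mhh_run s G G']: from the current list s of vertices with their residual
   degrees and the current graph G, the main loop succeeds with output G'. *)
Inductive mhh_run : seq (V * int) -> graph -> graph -> Prop :=
| mhh_done G : mhh_run [::] G G
| mhh_loop w e s G G' :
    (0 <= e <= (size s)%:Z)%R ->
    mhh_run (mhh_update `|e|%N s)
            (add_edges G w [seq x.1 | x <- take `|e|%N s]) G' ->
    mhh_run ((w, e) :: s) G G'.

Lemma walkP (G : graph) k u v :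
  reflect (exists p : seq V, [/\ size p = k, path (adj G) u p & last u p = v])
          (walk G k u v).
Proof.
apply: (iffP existsP) => [[p /andP[up /eqP pv]]|[p [/eqP sp up pv]]].
  by exists p; rewrite size_tuple.
by exists (Tuple sp); rewrite /= up pv eqxx.
Qed.

Lemma walk_short (G : graph) k u v :
  walk G k u v -> exists2 j, j <= k & (j < #|V|) && walk G j u v.
Proof.
case/walkP=> p [<- up <-]; case/shortenP: up => p' up' Up' sub.
exists (size p'); first by apply: uniq_leq_size => //; case/andP: Up'.
rewrite -[(size p').+1]/(size (u :: p')) -(card_uniqP Up') max_card /=.
by apply/walkP; exists p'.
Qed.

Lemma dist_Some (G : graph) u v k :
  dist G u v = Some k <->
  walk G k u v /\ forall j, walk G j u v -> k <= j.
Proof.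
rewrite /dist; set s := [seq _ <- _ | _].
have mem_s j : (j \in s) = walk G j u v && (j < #|V|).
  by rewrite mem_filter mem_iota add0n.
have sorted_s : sorted leq s.
  exact: sorted_filter leq_trans _ _ (iota_sorted 0 #|V|).
have min_s x t : s = x :: t -> forall j, walk G j u v -> x <= j.
  move=> def_s j /walk_short[i le_ij /andP[ltiV wi]]; apply: leq_trans le_ij.
  have: i \in s by rewrite mem_s wi ltiV.
  move: sorted_s; rewrite def_s /= (path_sortedE leq_trans) => /andP[/allP le_x _].
  by rewrite inE => /predU1P[->|/le_x].
split.
  case def_s: s => [|x t] //= [<-]; split; last exact: min_s def_s.
  by have := mem_s x; rewrite def_s mem_head => /esym/andP[].
case=> wk min_k; case def_s: s => [|x t] /=.
  have [i _ /andP[ltiV wi]] := walk_short wk.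
  by have := mem_s i; rewrite def_s wi ltiV.
have wx : walk G x u v by have := mem_s x; rewrite def_s mem_head => /esym/andP[].
by congr Some; apply/eqP; rewrite eqn_leq (min_s _ _ def_s) //= min_k.
Qed.

Lemma dist_None (G : graph) u v :
  dist G u v = None <-> ~~ connect (adj G) u v.
Proof.
split=> [dN|nuv].
  apply/negP => /connectP[p up vp].
  have: exists k, walk G k u v by exists (size p); apply/walkP; exists p.
  case/ex_minnP=> k wk mink.
  by have := proj2 (dist_Some G u v k) (conj wk mink); rewrite dN.
case Ed: (dist G u v) => [k|] //; case/negP: nuv.
case/dist_Some: Ed => /walkP[p [_ up vp]] _.
by apply/connectP; exists p.
Qed.

End Graphs.

(* The vertex v_i is the element of value i - 1 in 'I_n. *)
Definition mhh_output (n : nat) (d : n.-tuple int) (G : graph 'I_n) : Prop :=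
  mhh_run [seq (i, tnth d i) | i <- enum 'I_n] (edgeless 'I_n) G.

Definition first_induced (n : nat) (G : graph 'I_n) (i : nat) : graph 'I_n :=
  induced G [set j : 'I_n | j < i].

(* Main.v *)
Require Import Defs.
From mathcomp Require Import all_boot all_order all_algebra.

(** The algorithm joins the head [a] of the list to an initial segment of the
    remaining list.  Let [a < b < x] be vertices such that [a] and [b] are
    both adjacent to [x].  The edge from [b] to [x] can only be created when [b]
    is the head, so [b] is still in the list when [a] is the head; it precedes
    [x] there, so the segment that reaches [x] also contains [b], and [a] and
    [b] are adjacent.  Hence the neighbours of each vertex among the earlier
    ones form a clique ([mhh_run_clique]): the reverse of the order of the
    vertices is a perfect elimination order of the output.

    Deleting a vertex [x] whose neighbours form a clique does not increase
    distances, since a walk passing through [x] can be shortcut along the edge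
    between the vertices before and after [x] ([simplicial_shortcut]).  Deleting
    the last vertices one at a time turns any walk of [G] between vertices of
    [G_i] into a walk of [G_i] that is no longer ([first_induced_walk]), which
    is what isometry means ([isometric_of_walks]).  As [G_i] has [i] vertices,
    the graph is distance-preserving. *)

Set Implicit Arguments.
Unset Strict Implicit.
Unset Printing Implicit Defensive.

(** * Isometric subgraphs and simplicial vertices *)

Section Isometry.

Variable V : finType.
Implicit Types (G H : graph V) (A : {set V}).

Lemma induced_subgraph G A : subgraph (induced G A) G.
Proof. by split=> [|u v /and3P[]//]; apply: subsetIl. Qed.

Lemma walk_subgraph H G k u v : subgraph H G -> walk H k u v -> walk G k u v.
Proof.
by move=> [_ sHG] /walkP[p [sp up pv]]; apply/walkP; exists p; rewrite (sub_path sHG).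
Qed.

Lemma connect_subgraph H G u v :
  subgraph H G -> connect (adj H) u v -> connect (adj G) u v.
Proof. by move=> [_ sHG]; apply: connect_sub => x y /sHG; apply: connect1. Qed.

(** A walk of [H] is a walk of [G], so it is no shorter than a shortest walk of
    [G]; an upper bound on the length of walks in [H] thus gives equality. *)
Lemma isometric_of_walks H G :
    subgraph H G ->
    {in vset H &, forall u v k, walk G k u v -> exists2 j, j <= k & walk H j u v} ->
  isometric_subgraph H G.
Proof.
move=> sHG shorten; split=> // u v uH vH.
case distG: (dist G u v) => [k|].
  have [wk min_k] := proj1 (dist_Some G u v k) distG.
  have [j le_jk wj] := shorten u v uH vH k wk.
  have eq_jk : j = k.
    by apply/eqP; rewrite eqn_leq le_jk min_k //; apply: walk_subgraph wj.
  apply/dist_Some; rewrite -eq_jk; split=> // i wi.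
  by rewrite eq_jk min_k //; apply: walk_subgraph wi.
apply/dist_None; have/dist_None := distG; apply: contra.
exact: connect_subgraph.
Qed.

(** A walk from [u] to [v] passes through [x] only between two neighbours of [x]
    in [A], which are equal or adjacent, so [x] can be left out. *)
Lemma simplicial_shortcut G A (x : V) u v k :
    {in A &, forall y z, adj G y x -> adj G z x -> y != z -> adj G y z} ->
    u \in A -> v \in A -> x \notin A ->
    walk (induced G (x |: A)) k u v ->
  exists2 j, j <= k & walk (induced G A) j u v.
Proof.
move=> clique uA vA xA; have [m] := ubnP k.
elim: m k u uA => // m IHm [|k] u uA lt_km /walkP[p [sp up pv]].
  by exists 0 => //; apply/walkP; exists [::]; case: p sp up pv.
case: p sp up pv => [//|y p] [sp] /= /andP[/and3P[uy _ yxA] yp] pv.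
have wyv : walk (induced G (x |: A)) k y v by apply/walkP; exists p.
case/setU1P: yxA => [def_y|yA]; last first.
  have [j le_jk /walkP[q [sq yq qv]]] := IHm k y yA lt_km wyv.
  exists j.+1 => //; apply/walkP; exists (y :: q).
  by rewrite /= /induced_adj /= sq uy uA yA.
(* The walk does not end at x, so it goes on from x to some z in A, and the
   two steps from u to z are replaced by at most one. *)
rewrite {y}def_y in uy yp pv wyv *.
case: p sp yp pv {wyv} => [|z p] sp /= yp pv; first by rewrite pv vA in xA.
case/andP: yp => /and3P[xz _ zxA] zp.
have zA : z \in A.
  by case/setU1P: zxA xz => // ->; rewrite adj_irr.
have ltpm : size p < m by rewrite -ltnS (leq_trans _ lt_km) // -sp.
have wzv : walk (induced G (x |: A)) (size p) z v by apply/walkP; exists p.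
have [j le_jp wj] := IHm (size p) z zA ltpm wzv.
have [-> | neq_uz] := eqVneq u z.
  by exists j => //; rewrite -sp (leq_trans le_jp) // leqW.
exists j.+1; first by rewrite -sp /= !ltnS leqW.
case/walkP: wj => q [sq zq qv]; apply/walkP; exists (z :: q).
by rewrite /= /induced_adj /= sq uA zA clique // adj_sym.
Qed.

End Isometry.

(** * Elimination order of the output *)

Section Algorithm.

Variable n : nat.
Implicit Types (G : graph 'I_n) (s : seq ('I_n * int)).

Definition earlier_clique G :=
  forall a b x : 'I_n, a < b -> b < x -> adj G a x -> adj G b x -> adj G a b.

Lemma mhh_update_subseq k s :
  subseq [seq x.1 | x <- mhh_update k s] [seq x.1 | x <- s].
Proof.
rewrite -[X in subseq _ (map _ X)](cat_take_drop k s).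
apply: subseq_trans (map_subseq _ (filter_subseq _ _)) _.
by rewrite !map_cat -map_comp.
Qed.

Lemma take_pairwise_initial (T : eqType) (r : rel T) k (s : seq T) x y :
    pairwise r s -> x \in take k s -> y \in s -> ~~ r x y -> y \in take k s.
Proof.
rewrite -{1 3}(cat_take_drop k s) pairwise_cat mem_cat => /andP[/allrelP r_s _].
by move=> xs /orP[//|/(r_s x y xs) ->].
Qed.

(** The invariant of the main loop is that the vertices still in the list
    ([b \in t]) are later than every vertex that is already joined to a later
    one, and that [a] is adjacent to [b] also when [b] is in the list, since
    the edge from [b] to [x] may still be created. *)
Lemma mhh_run_clique s G G' :
    mhh_run s G G' ->
    let t := [seq x.1 | x <- s] in
    pairwise (fun i j : 'I_n => i < j) t ->
    vset G = setT ->
    (forall a x : 'I_n, a < x -> adj G a x -> {in t, forall b : 'I_n, a < b}) ->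
    (forall a b x : 'I_n, a < b -> b < x -> adj G a x ->
       (b \in t) || adj G b x -> adj G a b) ->
  vset G' = setT /\ earlier_clique G'.
Proof.
elim=> {s G G'} [G|w e s G G' _ _ IHrun] t.
  by move=> _ vG _ cl; split=> // a b x ab bx ax bx'; apply: (cl a b x); rewrite ?bx'.
move=> /= /andP[/allP w_lt s_lt] vG done_lt cl.
set k := `|e|%N in IHrun *; set t0 := [seq x.1 | x <- s] in w_lt s_lt done_lt cl *.
have sub_t := mem_subseq (mhh_update_subseq k s); rewrite -/t0 in sub_t.
rewrite map_take -/t0 in IHrun.
have w_lt_take y : y \in take k t0 -> w < y by move/mem_take/w_lt.
have new_edge (a x : 'I_n) : a < x ->
    adj (add_edges G w (take k t0)) a x = adj G a x || (a == w) && (x \in take k t0).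
  move=> ax; rewrite /= /add_edges_adj /= vG !inE /= neq_ltn ax /=; congr (_ || _).
  have [def_x|_] := eqVneq x w; last by rewrite orbF.
  rewrite {x}def_x in ax *.
  have [/w_lt_take wa|] := boolP (a \in _); last by rewrite orbF.
  by rewrite ltnNge ltnW in ax.
apply: IHrun => //.
- exact: subseq_pairwise (mhh_update_subseq k s) s_lt.
- move=> a x ax; rewrite new_edge // => /orP[Gax|/andP[/eqP-> _]] b /sub_t bt.
    by apply: (done_lt a x) => //; rewrite inE bt orbT.
  exact: w_lt.
move=> a b x ab bx; rewrite !new_edge ?(ltn_trans ab bx) //.
case/orP=> [Gax|/andP[/eqP def_a xT]].
  move=> bP; rewrite (cl a b x) //= inE.
  by case/or3P: bP => [/sub_t->|->|/andP[-> _]]; rewrite ?orbT.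
rewrite {a}def_a eqxx /= in ab *.
case/or3P=> [/sub_t bt|Gbx|/andP[/eqP def_b _]].
- rewrite (take_pairwise_initial s_lt xT bt) ?orbT //.
  by rewrite -leqNgt ltnW.
- (* Such a b has been a head already, but the current head w precedes it. *)
  have bw : b < w by apply: (done_lt b x) => //; rewrite mem_head.
  by rewrite ltnNge ltnW in ab.
- by rewrite def_b ltnn in ab.
Qed.

Lemma mhh_output_clique (d : n.-tuple int) G :
  mhh_output d G -> vset G = setT /\ earlier_clique G.
Proof.
move/mhh_run_clique; apply=> //; rewrite -map_comp map_id.
rewrite -sorted_pairwise; last by move=> j i k; apply: ltn_trans.
rewrite -(sorted_map (f := val) (e' := ltn)) val_enum_ord.
exact: iota_ltn_sorted.
Qed.

Lemma first_induced_walk G i (u v : 'I_n) k :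
    earlier_clique G -> i <= n -> u < i -> v < i -> walk G k u v ->
  exists2 j, j <= k & walk (first_induced G i) j u v.
Proof.
move=> cl le_in; rewrite -(subKn le_in).
(* The induction is on the number of last vertices that are deleted. *)
elim: (n - i) => [|m IHm].
  rewrite subn0 => _ _ /walkP[p [sp up pv]]; exists k => //.
  apply/walkP; exists p; split=> //; apply: sub_path up => x y xy.
  by rewrite /= /induced_adj /= xy !inE !ltn_ord.
have [/eqP nm|lt_mn] := leqP n m; first by rewrite subnS nm.
set x0 := n - m.+1 => ux vx wk.
have def_nm : n - m = x0.+1 by rewrite /x0 subnSK.
have x0n : x0 < n by rewrite -def_nm leq_subr.
have [j le_jk] : exists2 j, j <= k & walk (first_induced G (n - m)) j u v.
  by apply: IHm; rewrite ?def_nm ?ltnS // ltnW.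
rewrite def_nm /first_induced.
have -> : [set y : 'I_n | y < x0.+1] = Ordinal x0n |: [set y : 'I_n | y < x0].
  by apply/setP=> y; rewrite !inE ltnS leq_eqVlt.
move=> wj; have [||||j' le_j' wj'] := simplicial_shortcut _ _ _ _ wj.
- move=> y z; rewrite !inE => yx zx yx' zx'.
  rewrite neq_ltn => /orP[yz|zy]; first exact: (cl y z (Ordinal x0n)).
  by rewrite adj_sym; apply: (cl z y (Ordinal x0n)).
- by rewrite inE.
- by rewrite inE.
- by rewrite inE ltnn.
by exists j' => //; apply: leq_trans le_jk.
Qed.

Lemma card_first_induced G i :
  vset G = setT -> i <= n -> #|vset (first_induced G i)| = i.
Proof.
move=> vG le_in; rewrite /= vG setTI -sum1dep_card.
by rewrite -(big_ord_widen n (fun=> 1) le_in) sum1_card card_ord.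
Qed.

End Algorithm.

Theorem theorem3p1 (n : nat) (d : n.-tuple int) (G : graph 'I_n)
    (d_decr : sorted >=%R d)
    (d_out : mhh_output d G)
    (G_conn : connected G) :
  (forall i : nat, 1 <= i <= n -> isometric_subgraph (first_induced G i) G)
  /\ distance_preserving G.
Proof.
have [vG cl] := mhh_output_clique d_out.
have iso i : 1 <= i <= n -> isometric_subgraph (first_induced G i) G.
  case/andP=> _ le_in; apply: isometric_of_walks (induced_subgraph _ _) _.
  move=> u v /setIP[_ ui] /setIP[_ vi] k; rewrite !inE in ui vi.
  exact: first_induced_walk.
split=> //; split=> // k; rewrite vG cardsT card_ord => k_n.
exists (first_induced G k); split; first exact: iso.
by case/andP: k_n => _; apply: card_first_induced.
Qed.
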